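(* Let $d\geq 4$ be even. The map $G_d\colon\mathbb{R}^3\to\mathbb{R}^3$ does not omit a half-space: there are no $v\in\mathbb{R}^3\setminus\{0\}$ and $c\in\mathbb{R}$ such that $\{w\in\mathbb{R}^3:\langle v,w\rangle\geq c\}\subseteq\mathbb{R}^3\setminus G_d(\mathbb{R}^3)$.
   Context: Put $A=1+xy$, $B=A^2z+y^2(4+3xy)$, $P=AB$, $Q=y+3xB$, $R=2x-3x^2y-x^3z$. For even $d\geq 4$, $G_d=(P,Q_d,R_d)\colon\mathbb{R}^3\to\mathbb{R}^3$ with $Q_d=Q+A^2x^{d-2}B^d$ and $R_d=R-\frac{d-2}{d}x^dB^d$. Here $\langle\cdot,\cdot\rangle$ is the standard inner product. *)

(* Defs.v *)
From HB Require Import structures.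
From mathcomp Require Import all_boot all_order all_algebra.
From mathcomp Require Import classical_sets reals.

Set Implicit Arguments.
Unset Strict Implicit.
Unset Printing Implicit Defensive.

Import Order.TTheory GRing.Theory Num.Theory.
Local Open Scope ring_scope.

Definition vec3 (R : realType) (a b c : R) : 'rV[R]_3 :=
  \row_(i < 3) [:: a; b; c]`_i.

Definition dot3 (R : realType) (v w : 'rV[R]_3) : R :=
  \sum_(i < 3) v 0 i * w 0 i.

Section Polynomials.
Variables (R : realType) (x y z : R).

Definition polA : R := 1 + x * y.
Definition polB : R := polA ^+ 2 * z + y ^+ 2 * (4%:R + 3%:R * x * y).
Definition polP : R := polA * polB.
Definition polQ : R := y + 3%:R * x * polB.
Definition polR : R := 2%:R * x - 3%:R * x ^+ 2 * y - x ^+ 3 * z.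

(* The subtraction in the exponent (d - 2) is truncated, which is harmless as
   the maps are considered for 4 <= d only. *)
Definition polQd (d : nat) : R :=
  polQ + polA ^+ 2 * x ^+ (d - 2) * polB ^+ d.
Definition polRd (d : nat) : R :=
  polR - (d%:R - 2%:R) / d%:R * x ^+ d * polB ^+ d.

End Polynomials.

(* The column indices 0, 1, 2%:R are read in the ring structure of 'I_3, where
   they are the ordinals with values 0, 1, 2. *)
Definition Gmap (R : realType) (d : nat) (p : 'rV[R]_3) : 'rV[R]_3 :=
  let x := p 0 0 in let y := p 0 1 in let z := p 0 2%:R in
  vec3 (polP x y z) (polQd x y z d) (polRd x y z d).

(* Main.v *)
(** Every affine plane meets the image of [G_d]: a plane transverse to the third
    axis already meets the image of the line [x = 1, y = -1], on which [A = 0]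
    and [B = 1], so that the first two coordinates are constant and the third
    is affine in [z]; a plane parallel to the third axis meets the image of
    [x = 0], on which [(P, Q_d) = (z + 4 y^2, y)] takes all values. *)
Require Import Defs.
From HB Require Import structures.
From mathcomp Require Import all_boot all_order all_algebra.
From mathcomp Require Import classical_sets reals.
From mathcomp Require Import ring.

Set Implicit Arguments.
Unset Strict Implicit.
Unset Printing Implicit Defensive.

Import Order.TTheory GRing.Theory Num.Theory.
Local Open Scope classical_set_scope.
Local Open Scope ring_scope.

Lemma dot3_Gmap (R : realType) (d : nat) (v : 'rV[R]_3) (x y z : R) :
  dot3 v (Gmap d (vec3 x y z)) =
  v 0 0 * polP x y z + v 0 1 * polQd x y z d + v 0 2%:R * polRd x y z d.
Proof.
rewrite /dot3 !big_ord_recl big_ord0 addr0 addrA /Gmap /vec3 !mxE /=.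
(* The indices left by [big_ord_recl] agree with [0], [1], [2%:R] only in value. *)
by congr (v 0 _ * _ + v 0 _ * _ + v 0 _ * _); apply: val_inj.
Qed.

Lemma dot3_Gmap_line (R : realType) (d : nat) (v : 'rV[R]_3) (z : R) :
  dot3 v (Gmap d (vec3 1 (-1) z)) =
  v 0 1 * 2%:R + v 0 2%:R * (5%:R - z - (d%:R - 2%:R) / d%:R).
Proof.
have A0 : polA 1 (-1) = 0 :> R by rewrite /polA; ring.
have B1 : polB 1 (-1) z = 1 by rewrite /polB A0; ring.
rewrite dot3_Gmap /polP /polQd /polRd /polQ /polR A0 B1 !expr1n.
by ring.
Qed.

Lemma dot3_Gmap_plane (R : realType) (d : nat) (v : 'rV[R]_3) (y z : R) :
  (2 < d)%N -> v 0 2%:R = 0 ->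
  dot3 v (Gmap d (vec3 0 y z)) = v 0 0 * (z + 4%:R * y ^+ 2) + v 0 1 * y.
Proof.
move=> d_gt2 v2; rewrite dot3_Gmap v2 /polP /polQd /polQ /polB /polA.
(* As [d - 2] is positive, [0 ^+ (d - 2)] vanishes, leaving [Q_d = y]. *)
by rewrite (expr0n _ (d - 2)) subn_eq0 leqNgt d_gt2 /=; ring.
Qed.

Lemma dot3_Gmap_surj (R : realType) (d : nat) (v : 'rV[R]_3) (c : R) :
  (2 < d)%N -> v != 0 -> exists p, dot3 v (Gmap d p) = c.
Proof.
move=> d_gt2 v_neq0; have [v2|v2] := eqVneq (v 0 2%:R) 0; last first.
  exists (vec3 1 (-1) (5%:R - (d%:R - 2%:R) / d%:R
                       - (c - v 0 1 * 2%:R) / v 0 2%:R)).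
  (* With the quotient abstracted, [field] divides only by [v 0 2%:R]. *)
  rewrite dot3_Gmap_line; set q := (_ - _) / d%:R.
  by field.
have n_neq0 : v 0 0 ^+ 2 + v 0 1 ^+ 2 != 0.
  apply: contraNneq v_neq0 => /eqP.
  rewrite paddr_eq0 ?sqr_ge0// !sqrf_eq0 => /andP[/eqP v0 /eqP v1].
  apply/eqP/rowP => i; rewrite mxE.
  by case: i => [[|[|[|//]]] lti]; [rewrite -[RHS]v0 | rewrite -[RHS]v1
    | rewrite -[RHS]v2]; congr (v 0 _); apply: val_inj.
(* The target for [(P, Q_d)] is [t (v_0, v_1)], the foot of the perpendicular from the origin to the
   line [v_0 a + v_1 b = c]; the third coordinate of the witness cancels [4 y^2] in [P]. *)
pose t := c / (v 0 0 ^+ 2 + v 0 1 ^+ 2).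
exists (vec3 0 (v 0 1 * t) (v 0 0 * t - 4%:R * (v 0 1 * t) ^+ 2)).
by rewrite dot3_Gmap_plane// /t; field.
Qed.

Theorem corollary8 (R : realType) (d : nat) (hd4 : (4 <= d)%N)
    (hdeven : ~~ odd d) :
  ~ (exists (v : 'rV[R]_3) (c : R),
       v <> 0 /\
       [set w : 'rV[R]_3 | c <= dot3 v w] `<=` ~` range (@Gmap R d)).
Proof.
move=> [v [c [/eqP v_neq0 omitted]]].
(* The boundary plane of the closed half-space already meets the image. *)
have [p dotE] := dot3_Gmap_surj c (ltnW hd4) v_neq0.
by apply: (omitted (Gmap d p)); [rewrite /= dotE | exists p].
Qed.
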